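(* For every duplicative forest $\mathfrak{f}$, the poset $\mathcal{D}^*(\mathfrak{f}) = \{\mathfrak{f}' : \mathfrak{f} \ll \mathfrak{f}'\}$ is isomorphic to a maximal interval of a Mockingbird lattice, i.e. there exist $d \geq 0$ and an element $\mathfrak{a}$ of $\mathrm{M}(d)$ such that $\mathcal{D}^*(\mathfrak{f})$ is isomorphic as a poset to the interval $\{\mathfrak{u} \in \mathrm{M}(d) : \mathfrak{a} \preccurlyeq \mathfrak{u}\}$ (the interval from $\mathfrak{a}$ to the greatest element of $\mathrm{M}(d)$).
   Context: Duplicative trees and forests are defined mutually: a duplicative forest is a finite word $\mathfrak{f}(1)\cdots\mathfrak{f}(\ell)$ ($\ell\ge 0$) of duplicative trees (the empty word $\epsilon$ is the empty forest), and a duplicative tree is $\circ(\mathfrak{g})$ or $\bullet(\mathfrak{g})$ for a duplicative forest $\mathfrak{g}$, i.e. a planar rooted tree whose nodes are each white ($\circ$) or black ($\bullet$), with root of that color and the trees of $\mathfrak{g}$ as subtrees of the root. Concatenation of forests is written $\cdot$. The relation $\lessdot$ on forests: $\mathfrak{f} \lessdot \mathfrak{f}'$ iff $\mathfrak{f}'$ is obtained from $\mathfrak{f}$ by choosing one white node, whose subtree is $\circ(\mathfrak{g})$, and replacing this subtree by $\bullet(\mathfrak{g}\cdot\mathfrak{g})$ (turn the node black and duplicate its sequence of child subtrees). $\ll$ is the reflexive transitive closure of $\lessdot$; it is a partial order. Terms over $\{\mathsf{M}\}$: variables $\mathsf{x}_i$, the constant $\mathsf{M}$, and applications $\mathfrak{t}_1\mathfrak{t}_2$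 (binary trees; juxtaposition left-associative). $\mathfrak{t}\Rightarrow\mathfrak{t}'$ iff $\mathfrak{t}'$ is obtained from $\mathfrak{t}$ by replacing one subterm $\mathsf{M}\mathfrak{s}$ by $\mathfrak{s}\mathfrak{s}$; $\preccurlyeq$ is the reflexive transitive closure of $\Rightarrow$ (a partial order). For a term $\mathfrak{t}$, $\mathcal{P}(\mathfrak{t})$ is the poset $\{\mathfrak{t}' : \mathfrak{t}\preccurlyeq\mathfrak{t}'\}$. The Mockingbird lattice of order $d\ge0$ is $\mathrm{M}(d) := \mathcal{P}(\mathfrak{r}_d)$ where $\mathfrak{r}_0 := \mathsf{M}$ and $\mathfrak{r}_d := \mathsf{M}\mathfrak{r}_{d-1}$ for $d\ge1$; it is a finite lattice. *)

(* Defs.v *)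
From Stdlib Require Import List Relations.
Import ListNotations.

Inductive color : Set := White | Black.

Inductive dtree : Set := Node (c : color) (g : list dtree).

Definition dforest : Set := list dtree.

Inductive dtree_step : dtree -> dtree -> Prop :=
| dtree_step_root (g : dforest) :
    dtree_step (Node White g) (Node Black (g ++ g))
| dtree_step_child (c : color) (g g' : dforest) :
    dforest_step g g' -> dtree_step (Node c g) (Node c g')
with dforest_step : dforest -> dforest -> Prop :=
| dforest_step_at (f1 f2 : dforest) (t t' : dtree) :
    dtree_step t t' -> dforest_step (f1 ++ t :: f2) (f1 ++ t' :: f2).

Definition dforest_le : dforest -> dforest -> Prop :=
  clos_refl_trans dforest dforest_step.

Definition Dstar (f : dforest) : dforest -> Prop :=
  fun f' => dforest_le f f'.

Inductive term : Set :=
| Var (i : nat)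
| M
| App (t1 t2 : term).

Inductive term_step : term -> term -> Prop :=
| term_step_root (s : term) : term_step (App M s) (App s s)
| term_step_left (t1 t1' t2 : term) :
    term_step t1 t1' -> term_step (App t1 t2) (App t1' t2)
| term_step_right (t1 t2 t2' : term) :
    term_step t2 t2' -> term_step (App t1 t2) (App t1 t2').

Definition term_le : term -> term -> Prop :=
  clos_refl_trans term term_step.

Definition term_poset (t : term) : term -> Prop :=
  fun t' => term_le t t'.

Fixpoint right_comb (d : nat) : term :=
  match d with
  | O => M
  | S d' => App M (right_comb d')
  end.

Definition Mockingbird (d : nat) : term -> Prop := term_poset (right_comb d).

(* The posets here are subsets [P], [Q] of ambient ordered types, with the
   induced orders; the values of [phi] outside [P] are irrelevant. *)
Definition poset_isomorphic {A B : Type}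
    (leA : A -> A -> Prop) (P : A -> Prop)
    (leB : B -> B -> Prop) (Q : B -> Prop) : Prop :=
  exists phi : A -> B,
    (forall x, P x -> Q (phi x)) /\
    (forall x x', P x -> P x' -> phi x = phi x' -> x = x') /\
    (forall y, Q y -> exists x, P x /\ phi x = y) /\
    (forall x x', P x -> P x' -> (leA x x' <-> leB (phi x) (phi x'))).

(* Main.v *)
(* The interval above an element [a] of M(d) is the whole up-set of [a], so it
   suffices to find, for each forest, a term of some M(d) with the same up-set.
   Such terms are built by induction on forests. If [s <> M], the terms above
   [M s] are the [M s'] with [s'] above [s] and the [s1 s2] with [s1], [s2] above
   [s]; this matches a white node, since the forests above [g ++ g] are the
   [h1 ++ h2] with [h1], [h2] above [g]. If [a <> M], the up-set of [a b] is the
   product of those of [a] and [b]; this matches adding a tree to a forest. For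
   [a b] to lie in M(d+1) it is enough that [a] and [b] lie in the same M(d), and
   [a] is moved to M(d+1), without changing its up-set, by applying it to the
   greatest element of M(d). *)

From Stdlib Require Import Arith List Relations Lia.
Require Import Defs.
Import ListNotations.

Lemma clos_rt_map {A B : Type} (R : relation A) (S : relation B) (h : A -> B)
    (x y : A) :
  (forall x y, R x y -> S (h x) (h y)) ->
  clos_refl_trans A R x y -> clos_refl_trans B S (h x) (h y).
Proof.
  intros H Hxy; induction Hxy.
  - now apply rt_step, H.
  - apply rt_refl.
  - eapply rt_trans; eassumption.
Qed.

(** Main tool for describing up-sets: a guessed shape of the elements above [x] only has to be
    checked at [x] and along one step. *)
Lemma clos_rt_invariant {A : Type} (R : relation A) (P : A -> Prop) (x y : A) :
  P x -> (forall y z, P y -> R y z -> P z) -> clos_refl_trans A R x y -> P y.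
Proof.
  intros Hx HP Hxy; revert Hx; induction Hxy; eauto.
Qed.

(** * Terms *)

Lemma term_le_App (a a' b b' : term) :
  term_le a a' -> term_le b b' -> term_le (App a b) (App a' b').
Proof.
  intros Ha Hb; apply rt_trans with (App a' b).
  - apply (clos_rt_map term_step _ (fun u => App u b)); auto using term_step_left.
  - apply (clos_rt_map term_step); auto using term_step_right.
Qed.

Lemma term_le_dup (s s1 s2 : term) :
  term_le s s1 -> term_le s s2 -> term_le (App M s) (App s1 s2).
Proof.
  intros H1 H2; apply rt_trans with (App s s).
  - apply rt_step, term_step_root.
  - now apply term_le_App.
Qed.

(** Every step ends in an application. Hence a left factor other than [M] never becomes [M], and no
    redex can appear at the root above it. *)
Lemma term_le_neq_M (a u : term) : a <> M -> term_le a u -> u <> M.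
Proof.
  intros Ha; apply (clos_rt_invariant term_step (fun v => v <> M)); auto.
  intros y z _ Hyz; destruct Hyz; discriminate.
Qed.

(** The root never becomes a redex, so each step takes place inside one of the two factors. *)
Lemma term_le_App_inv (a b u : term) :
  a <> M -> term_le (App a b) u ->
  exists a' b', u = App a' b' /\ term_le a a' /\ term_le b b'.
Proof.
  intros Ha; apply (clos_rt_invariant term_step
    (fun u => exists a' b', u = App a' b' /\ term_le a a' /\ term_le b b')).
  - exists a, b; repeat split; apply rt_refl.
  - intros y z (a' & b' & -> & Ha' & Hb') Hz; inversion Hz; subst.
    + now destruct (term_le_neq_M a M).
    + exists t1', b'; repeat split; auto.
      apply rt_trans with a'; auto using rt_step.
    + exists a', t2'; repeat split; auto.
      apply rt_trans with b'; auto using rt_step.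
Qed.

Lemma term_le_App_iff (a a' b b' : term) :
  a <> M -> (term_le (App a b) (App a' b') <-> term_le a a' /\ term_le b b').
Proof.
  intros Ha; split.
  - intros H; apply term_le_App_inv in H as (x & y & [= -> ->] & H); auto.
  - intros []; now apply term_le_App.
Qed.

(** Before the root fires, [M] is inert and only the argument moves. Firing at [s'] gives
    [App s' s'], whose left factor is not [M], so from then on the two copies evolve
    independently. *)
Lemma term_le_M_inv (s u : term) :
  s <> M -> term_le (App M s) u ->
  (exists s', u = App M s' /\ term_le s s') \/
  (exists s1 s2, u = App s1 s2 /\ term_le s s1 /\ term_le s s2).
Proof.
  intros Hs; apply (clos_rt_invariant term_step
    (fun u => (exists s', u = App M s' /\ term_le s s') \/
              (exists s1 s2, u = App s1 s2 /\ term_le s s1 /\ term_le s s2))).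
  - left; exists s; split; auto; apply rt_refl.
  - intros y z [(s' & -> & Hs') | (s1 & s2 & -> & H1 & H2)] Hz.
    + inversion Hz as [? | ? ? ? Hz' | ? ? ? Hz']; subst.
      * right; exists s', s'; auto.
      * inversion Hz'.
      * left; exists t2'; split; auto.
        apply rt_trans with s'; auto using rt_step.
    + right; destruct (term_le_App_inv s1 s2 z) as (a & b & -> & Ha & Hb).
      * now apply (term_le_neq_M s).
      * now apply rt_step.
      * exists a, b; split; [auto | split].
        -- now apply rt_trans with s1.
        -- now apply rt_trans with s2.
Qed.

Lemma term_le_M_iff (s s' : term) :
  s <> M -> (term_le (App M s) (App M s') <-> term_le s s').
Proof.
  intros Hs; split.
  - intros H; apply term_le_M_inv in H as [(x & [= ->] & H) | (x & y & E & H & _)]; auto.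
    injection E as <- _; now destruct (term_le_neq_M s M).
  - apply term_le_App, rt_refl.
Qed.

Lemma term_le_dup_iff (s s1 s2 : term) :
  s <> M -> s1 <> M ->
  (term_le (App M s) (App s1 s2) <-> term_le s s1 /\ term_le s s2).
Proof.
  intros Hs Hs1; split.
  - intros H; apply term_le_M_inv in H as [(x & [= -> _] & _) | (x & y & [= -> ->] & H)]; tauto.
  - intros []; now apply term_le_dup.
Qed.

Lemma not_term_le_App_M (a b s : term) : a <> M -> ~ term_le (App a b) (App M s).
Proof.
  intros Ha H; apply term_le_App_iff in H as [H _]; auto.
  now destruct (term_le_neq_M a M).
Qed.

Lemma Mockingbird_dup (d : nat) (a b : term) :
  Mockingbird d a -> Mockingbird d b -> Mockingbird (S d) (App a b).
Proof. apply term_le_dup. Qed.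

Lemma Mockingbird_M (d : nat) (a : term) :
  Mockingbird d a -> Mockingbird (S d) (App M a).
Proof. apply term_le_App, rt_refl. Qed.

(** The complete binary tree of height [d] with all leaves [M], which is the greatest element of
    M(d). *)
Fixpoint top (d : nat) : term :=
  match d with
  | O => M
  | S d' => App (top d') (top d')
  end.

Lemma Mockingbird_top (d : nat) : Mockingbird d (top d).
Proof.
  induction d; [apply rt_refl | now apply Mockingbird_dup].
Qed.

(** The term [App M M] steps to itself, so maximality takes the form of an equality rather than the
    absence of steps. *)
Lemma term_step_top (d : nat) (u : term) : term_step (top d) u -> u = top d.
Proof.
  revert u; induction d as [|d IH]; intros u Hu; inversion Hu; subst; cbn; f_equal; auto.
Qed.

Lemma term_le_top (d : nat) (u : term) : term_le (top d) u -> u = top d.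
Proof.
  apply (clos_rt_invariant term_step (fun v => v = top d)); auto.
  intros y z ->; apply term_step_top.
Qed.

(** * Duplicative forests *)

Definition dtree_le : dtree -> dtree -> Prop := clos_refl_trans dtree dtree_step.

Lemma dforest_le_cons (t t' : dtree) (f f' : dforest) :
  dtree_le t t' -> dforest_le f f' -> dforest_le (t :: f) (t' :: f').
Proof.
  intros Ht Hf; apply rt_trans with (t' :: f).
  - apply (clos_rt_map dtree_step _ (fun u => u :: f)); auto.
    intros x y Hxy; exact (dforest_step_at [] f x y Hxy).
  - apply (clos_rt_map dforest_step); auto.
    intros x y [f1 f2 u u' Hu]; exact (dforest_step_at (t' :: f1) f2 u u' Hu).
Qed.

(** A step changes one tree and keeps the number of trees, so the order on forests is a product
    order. *)
Lemma dforest_le_Forall2 (f g : dforest) : dforest_le f g <-> Forall2 dtree_le f g.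
Proof.
  assert (Hrefl : forall h, Forall2 dtree_le h h).
  { intros h; induction h; constructor; auto; apply rt_refl. }
  split.
  - intros H; induction H as [f g [f1 f2 t t' Ht] | f | f g h _ IH1 _ IH2]; auto.
    + apply Forall2_app; auto.
      constructor; auto; now apply rt_step.
    + revert h IH2; induction IH1 as [|x y f g Hxy _ IH]; intros h Hh;
        inversion Hh; subst; constructor; auto.
      eapply rt_trans; eassumption.
  - intros H; induction H; [apply rt_refl | now apply dforest_le_cons].
Qed.

Lemma dforest_le_cons_iff (t t' : dtree) (f f' : dforest) :
  dforest_le (t :: f) (t' :: f') <-> dtree_le t t' /\ dforest_le f f'.
Proof.
  rewrite !dforest_le_Forall2; apply Forall2_cons_iff.
Qed.

Lemma dforest_le_length (f g : dforest) : dforest_le f g -> length g = length f.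
Proof.
  rewrite dforest_le_Forall2; intros H; symmetry; eapply Forall2_length; eassumption.
Qed.

Lemma dforest_le_app (f f' g g' : dforest) :
  dforest_le f f' -> dforest_le g g' -> dforest_le (f ++ g) (f' ++ g').
Proof.
  rewrite !dforest_le_Forall2; apply Forall2_app.
Qed.

Lemma dforest_le_app_inv (f g h : dforest) :
  dforest_le (f ++ g) h ->
  exists f' g', h = f' ++ g' /\ dforest_le f f' /\ dforest_le g g'.
Proof.
  rewrite dforest_le_Forall2.
  intros H; apply Forall2_app_inv_l in H as (f' & g' & Hf & Hg & ->).
  exists f', g'; now rewrite !dforest_le_Forall2.
Qed.

Lemma dforest_le_app_iff (f f' g g' : dforest) :
  length f' = length f ->
  (dforest_le (f ++ g) (f' ++ g') <-> dforest_le f f' /\ dforest_le g g').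
Proof.
  intros Hl; split.
  - intros H; apply dforest_le_app_inv in H as (x & y & He & Hx & Hy).
    (* The two decompositions differ by a block [l], which equality of lengths forces to be
       empty. *)
    apply app_eq_app in He as (l & He).
    apply dforest_le_length in Hx as Hx'.
    destruct He as [[-> ->] | [-> ->]]; rewrite length_app in *;
      (destruct l; [| cbn in *; lia]); rewrite ?app_nil_r in *; auto.
  - intros []; now apply dforest_le_app.
Qed.

Lemma dtree_le_Node (c : color) (g g' : dforest) :
  dforest_le g g' -> dtree_le (Node c g) (Node c g').
Proof.
  apply clos_rt_map; intros x y; apply dtree_step_child.
Qed.

Lemma dtree_le_dup (g h : dforest) :
  dforest_le (g ++ g) h -> dtree_le (Node White g) (Node Black h).
Proof.
  intros H; apply rt_trans with (Node Black (g ++ g)).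
  - apply rt_step, dtree_step_root.
  - now apply dtree_le_Node.
Qed.

Lemma dtree_le_Black_inv (g : dforest) (t : dtree) :
  dtree_le (Node Black g) t -> exists g', t = Node Black g' /\ dforest_le g g'.
Proof.
  apply (clos_rt_invariant dtree_step
           (fun t => exists g', t = Node Black g' /\ dforest_le g g')).
  - exists g; split; auto; apply rt_refl.
  - intros y z (g' & -> & Hg') Hz; inversion Hz as [|c k k' Hk]; subst.
    exists k'; split; auto.
    apply rt_trans with g'; auto; now apply rt_step.
Qed.

(** If the root turns black at [g'], the result [g' ++ g'] is already above [g ++ g]. Duplicating
    first therefore reaches every black outcome. *)
Lemma dtree_le_White_inv (g : dforest) (t : dtree) :
  dtree_le (Node White g) t ->
  (exists g', t = Node White g' /\ dforest_le g g') \/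
  (exists h, t = Node Black h /\ dforest_le (g ++ g) h).
Proof.
  apply (clos_rt_invariant dtree_step
    (fun t => (exists g', t = Node White g' /\ dforest_le g g') \/
              (exists h, t = Node Black h /\ dforest_le (g ++ g) h))).
  - left; exists g; split; auto; apply rt_refl.
  - intros y z [(g' & -> & Hg') | (h & -> & Hh)] Hz.
    + inversion Hz as [|c k k' Hk]; subst.
      * right; exists (g' ++ g'); split; auto; now apply dforest_le_app.
      * left; exists k'; split; auto.
        apply rt_trans with g'; auto; now apply rt_step.
    + right; apply rt_step, dtree_le_Black_inv in Hz as (k & -> & Hk).
      exists k; split; auto; eapply rt_trans; eassumption.
Qed.

Lemma dtree_le_Node_iff (c : color) (g g' : dforest) :
  dtree_le (Node c g) (Node c g') <-> dforest_le g g'.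
Proof.
  split; [| apply dtree_le_Node].
  intros H; destruct c.
  - apply dtree_le_White_inv in H as [(k & [= ->] & H) | (k & [=] & _)]; auto.
  - apply dtree_le_Black_inv in H as (k & [= ->] & H); auto.
Qed.

Lemma dtree_le_dup_iff (g h : dforest) :
  dtree_le (Node White g) (Node Black h) <-> dforest_le (g ++ g) h.
Proof.
  split; [| apply dtree_le_dup].
  intros H; apply dtree_le_White_inv in H as [(k & [=] & _) | (k & [= ->] & H)]; auto.
Qed.

Lemma not_dtree_le_Black_White (g h : dforest) :
  ~ dtree_le (Node Black g) (Node White h).
Proof.
  intros H; apply dtree_le_Black_inv in H as (k & [=] & _).
Qed.

(** Mutual induction for the nested type: it supplies a hypothesis on the list of children, with an
    inner induction on that list inside the fixpoint on trees. *)
Lemma dtree_dforest_ind (P : dtree -> Prop) (Q : dforest -> Prop) :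
  (forall c g, Q g -> P (Node c g)) -> Q [] ->
  (forall t f, P t -> Q f -> Q (t :: f)) -> forall f, Q f.
Proof.
  intros HN H0 HC.
  assert (HP : forall t, P t).
  { fix IH 1; intros [c g]; apply HN.
    induction g as [|t g IHg]; [exact H0 | exact (HC t g (IH t) IHg)]. }
  induction f; auto.
Qed.

(** * Realization of forests by terms *)

(** The condition [a <> M] makes the up-sets of [App a b] and [App M a] predictable. The order [d]
    is kept explicit so that two realizations can be brought to a common one. *)
Definition realizable {A : Type} (leA : A -> A -> Prop) (P : A -> Prop) (d : nat) : Prop :=
  exists a, Mockingbird d a /\ a <> M /\ poset_isomorphic leA P term_le (term_poset a).

Lemma realizable_S {A : Type} (leA : A -> A -> Prop) (P : A -> Prop) (d : nat) :
  realizable leA P d -> realizable leA P (S d).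
Proof.
  intros (a & Had & Ha & phi & Hphi & Hinj & Hsurj & Hle).
  exists (App a (top d)); split; [| split].
  - apply Mockingbird_dup; auto using Mockingbird_top.
  - discriminate.
  - exists (fun x => App (phi x) (top d)); split; [| split; [| split]].
    + intros x Hx; apply term_le_App; [now apply Hphi | apply rt_refl].
    + intros x x' Hx Hx' [=]; auto.
    + intros y Hy; apply term_le_App_inv in Hy as (u & v & -> & Hu & Hv); auto.
      apply term_le_top in Hv as ->.
      destruct (Hsurj u Hu) as (x & Hx & <-); eauto.
    + intros x x' Hx Hx'; rewrite term_le_App_iff, Hle; auto.
      * intuition; apply rt_refl.
      * now apply (term_le_neq_M a), Hphi.
Qed.

Lemma realizable_le {A : Type} (leA : A -> A -> Prop) (P : A -> Prop) (d d' : nat) :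
  d <= d' -> realizable leA P d -> realizable leA P d'.
Proof.
  intros H; induction H; auto using realizable_S.
Qed.

(** The up-set is a single point. Order 1 is chosen because [top 0] is [M], while [top 1] is
    [App M M]. *)
Lemma realizable_nil : realizable dforest_le (Dstar []) 1.
Proof.
  assert (Hnil : forall f, Dstar [] f -> f = []).
  { intros f Hf; apply dforest_le_length in Hf; now apply length_zero_iff_nil. }
  exists (top 1); split; [apply Mockingbird_top | split; [discriminate |]].
  exists (fun _ => top 1); split; [| split; [| split]].
  - intros; apply rt_refl.
  - intros f f' ->%Hnil ->%Hnil; auto.
  - intros y ->%term_le_top; exists []; split; auto; apply rt_refl.
  - intros f f' ->%Hnil ->%Hnil; split; intros; apply rt_refl.
Qed.

Lemma realizable_cons (t : dtree) (f : dforest) (d : nat) :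
  realizable dtree_le (dtree_le t) d -> realizable dforest_le (Dstar f) d ->
  realizable dforest_le (Dstar (t :: f)) (S d).
Proof.
  intros (a & Had & Ha & phi & Hphi & Hinj & Hsurj & Hle).
  intros (b & Hbd & Hb & psi & Hpsi & Hinj' & Hsurj' & Hle').
  assert (Hcons : forall h, Dstar (t :: f) h ->
            exists t' f', h = t' :: f' /\ dtree_le t t' /\ Dstar f f').
  { intros [|t' f'] H.
    - now apply dforest_le_length in H.
    - apply dforest_le_cons_iff in H; eauto. }
  exists (App a b); split; [now apply Mockingbird_dup | split; [discriminate |]].
  (* The value at [[]] is a dummy: forests above [t :: f] are nonempty. *)
  exists (fun h => match h with [] => M | t' :: f' => App (phi t') (psi f') end).
  split; [| split; [| split]].
  - intros h (t' & f' & -> & Ht & Hf)%Hcons.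
    apply term_le_App; [now apply Hphi | now apply Hpsi].
  - intros h h' (t1 & f1 & -> & Ht1 & Hf1)%Hcons (t2 & f2 & -> & Ht2 & Hf2)%Hcons [=].
    f_equal; auto.
  - intros y Hy; apply term_le_App_inv in Hy as (u & v & -> & Hu & Hv); auto.
    destruct (Hsurj u Hu) as (t' & Ht & <-), (Hsurj' v Hv) as (f' & Hf & <-).
    exists (t' :: f'); split; auto; now apply dforest_le_cons.
  - intros h h' (t1 & f1 & -> & Ht1 & Hf1)%Hcons (t2 & f2 & -> & Ht2 & Hf2)%Hcons.
    rewrite dforest_le_cons_iff, term_le_App_iff, Hle, Hle'; auto; [tauto |].
    now apply (term_le_neq_M a), Hphi.
Qed.

(** A black root is frozen, so the term realizing its children serves unchanged. *)
Lemma realizable_Black (g : dforest) (d : nat) :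
  realizable dforest_le (Dstar g) d -> realizable dtree_le (dtree_le (Node Black g)) d.
Proof.
  intros (a & Had & Ha & phi & Hphi & Hinj & Hsurj & Hle).
  exists a; split; [auto | split; [auto |]].
  exists (fun t : dtree => let (_, h) := t in phi h); split; [| split; [| split]].
  - intros x (h & -> & Hh)%dtree_le_Black_inv; now apply Hphi.
  - intros x x' (h & -> & Hh)%dtree_le_Black_inv (h' & -> & Hh')%dtree_le_Black_inv He.
    f_equal; auto.
  - intros y Hy; destruct (Hsurj y Hy) as (h & Hh & <-).
    exists (Node Black h); split; auto; now apply dtree_le_Node.
  - intros x x' (h & -> & Hh)%dtree_le_Black_inv (h' & -> & Hh')%dtree_le_Black_inv.
    rewrite dtree_le_Node_iff; auto.
Qed.

Lemma realizable_White (g : dforest) (d : nat) :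
  realizable dforest_le (Dstar g) d -> realizable dtree_le (dtree_le (Node White g)) (S d).
Proof.
  intros (a & Had & Ha & phi & Hphi & Hinj & Hsurj & Hle).
  set (n := length g).
  (* Forests above [g] all have length [n], so cutting at [n] recovers the evolved forms of the two
     copies of [g]. *)
  set (psi := fun t : dtree => match t with
              | Node White h => App M (phi h)
              | Node Black h => App (phi (firstn n h)) (phi (skipn n h))
              end).
  assert (Hinv : forall t, dtree_le (Node White g) t ->
            (exists g', t = Node White g' /\ Dstar g g') \/
            (exists h1 h2, t = Node Black (h1 ++ h2) /\ Dstar g h1 /\ Dstar g h2)).
  { intros t [H | (h & -> & (h1 & h2 & -> & H)%dforest_le_app_inv)]%dtree_le_White_inv;
      [now left | right; eauto]. }
  assert (Hpsi : forall h1 h2, Dstar g h1 ->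
            psi (Node Black (h1 ++ h2)) = App (phi h1) (phi h2)).
  { intros h1 h2 H1%dforest_le_length; unfold psi, n.
    rewrite <- H1, firstn_app, skipn_app, Nat.sub_diag, firstn_all, skipn_all.
    now rewrite app_nil_r. }
  assert (HM : forall h, Dstar g h -> phi h <> M).
  { intros h Hh; now apply (term_le_neq_M a), Hphi. }
  assert (Hlen : forall h h', Dstar g h -> Dstar g h' -> length h' = length h).
  { intros h h' Hh%dforest_le_length Hh'%dforest_le_length; congruence. }
  exists (App M a); split; [now apply Mockingbird_M | split; [discriminate |]].
  exists psi; split; [| split; [| split]].
  - intros x [(h & -> & Hh) | (h1 & h2 & -> & H1 & H2)]%Hinv.
    + apply term_le_App; [apply rt_refl | now apply Hphi].
    + rewrite Hpsi by auto; apply term_le_dup; now apply Hphi.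
  - intros x x' [(h & -> & Hh) | (h1 & h2 & -> & H1 & H2)]%Hinv
      [(k & -> & Hk) | (k1 & k2 & -> & K1 & K2)]%Hinv; rewrite ?Hpsi by auto; cbn;
      intros He; injection He.
    + intros; f_equal; auto.
    (* In the mixed cases the left factors decide: it is [M] for a white root and never [M] for a
       black one. *)
    + intros _ E; now destruct (HM k1).
    + intros _ E; now destruct (HM h1).
    + intros; do 2 f_equal; auto.
  - intros y [(u & -> & Hu) | (u & v & -> & Hu & Hv)]%term_le_M_inv; auto.
    + destruct (Hsurj u Hu) as (h & Hh & <-).
      exists (Node White h); split; auto; now apply dtree_le_Node.
    + destruct (Hsurj u Hu) as (h1 & H1 & <-), (Hsurj v Hv) as (h2 & H2 & <-).
      exists (Node Black (h1 ++ h2)); split; auto.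
      now apply dtree_le_dup, dforest_le_app.
  - intros x x' [(h & -> & Hh) | (h1 & h2 & -> & H1 & H2)]%Hinv
      [(k & -> & Hk) | (k1 & k2 & -> & K1 & K2)]%Hinv; rewrite ?Hpsi by auto; cbn.
    + rewrite dtree_le_Node_iff, term_le_M_iff; auto.
    + rewrite dtree_le_dup_iff, dforest_le_app_iff, term_le_dup_iff, !Hle; auto; tauto.
    (* Black below white: both sides fail, since neither a duplicated node nor a fired redex can be
       restored. *)
    + split; intros H; exfalso; revert H.
      * apply not_dtree_le_Black_White.
      * now apply not_term_le_App_M, HM.
    + rewrite dtree_le_Node_iff, dforest_le_app_iff, term_le_App_iff, !Hle; auto; tauto.
Qed.

Theorem theorem2p3p5 (f : dforest) :
  exists (d : nat) (a : term),
    Mockingbird d a /\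
    poset_isomorphic dforest_le (Dstar f)
                     term_le (fun u : term => Mockingbird d u /\ term_le a u).
Proof.
  assert (H : exists d, realizable dforest_le (Dstar f) d).
  { apply (dtree_dforest_ind
      (fun t => exists d, realizable dtree_le (dtree_le t) d)
      (fun f => exists d, realizable dforest_le (Dstar f) d)).
    - intros [|] g [d H]; eauto using realizable_White, realizable_Black.
    - eauto using realizable_nil.
    (* Tree and forest are first raised to the common order [d + e]; joining them adds one. *)
    - intros t f' [d Ht] [e Hf]; exists (S (d + e)); apply realizable_cons.
      + apply realizable_le with d; auto; lia.
      + apply realizable_le with e; auto; lia. }
  destruct H as (d & a & Had & _ & phi & Hphi & Hinj & Hsurj & Hle).
  exists d, a; split; auto.
  exists phi; split; [| split; [| split]]; auto.
  - intros x Hx; split; [| now apply Hphi].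
    apply rt_trans with a; auto; now apply Hphi.
  - intros y [_ Hy]; auto.
Qed.
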